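(* Let $\mathcal P\hookrightarrow\mathcal G\overset{q}{\twoheadrightarrow}\mathcal S$ be an extension of the Cartan inverse monoid $\mathcal S$ by the $\mathcal N$-Clifford inverse monoid $\mathcal P$, let $j:\mathcal S\to\mathcal G$ be an order-preserving section for $q$, and let $\mathfrak A$, $k_s\otimes x$, and $\sigma:\mathcal G\times\mathcal S\to\mathcal P$ be the associated right Hilbert $\mathcal N$-module, its elementary tensors, and the cocycle-like function (defined in the context). For $v\in\mathcal G$, $s\in\mathcal S$ and $x\in\mathcal N$, the formula $$\lambda(v)(k_s\otimes x):=k_{q(v)s}\otimes\sigma(v,s)x$$ determines a partial isometry $\lambda(v)\in\mathcal L(\mathfrak A)$. Moreover, $\lambda:\mathcal G\to\mathcal L(\mathfrak A)$ is a one-to-one representation of $\mathcal G$ as partial isometries in $\mathcal L(\mathfrak A)$.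
   Context: Inverse semigroups: the inverse of $s$ is $s^\dagger$, the idempotents are $\mathcal E(\mathcal S)$, the natural partial order is $s\le t$ iff $s=te$ for some idempotent $e$, and $s,t$ are orthogonal if $s^\dagger t=st^\dagger=0$. An inverse semigroup is fundamental if the only elements commuting with all idempotents are the idempotents. An inverse monoid $\mathcal S$ with $0$ is a complete Boolean inverse monoid if $\mathcal E(\mathcal S)$ is a Boolean algebra, $(\mathcal S,\le)$ is a meet semilattice, and every pairwise orthogonal family has a join. A Cartan inverse monoid is a fundamental complete Boolean inverse monoid such that the character (Stone) space of $\mathcal E(\mathcal S)$ is hyperstonean. For von Neumann algebras $\mathcal L\subseteq\mathcal N$, $\mathcal{GN}(\mathcal N,\mathcal L)$ is the set of partial isometries $v\in\mathcal N$ with $v^*\mathcal Lv\cup v\mathcal Lv^*\subseteq\mathcal L$. An $\mathcal N$-Clifford inverse monoid is an inverse monoid $\mathcal P=\mathcal{GN}(\mathcal N,\mathcal D)$ where $\mathcal D$ is a von Neumann subalgebra of the center $\mathcal Z(\mathcal N)$; then $\mathcal E(\mathcal P)=\operatorname{proj}(\mathcal D)$, and $\mathcal D$ is generated by $\mathcal E(\mathcal P)$. An (idempotent-separating) extension $\mathcal P\hookrightarrow\mathcal G\overset{q}{\twoheadrightarrow}\mathcal S$: $\mathcal G$ is an inverse monoid, the first map is an injective homomorphism (regarded as inclusion), $q$ is a surjective homomorphism, $\mathcal P=\{v\in\mathcal G: q(v)\in\mathcal E(\mathcal S)\}$, and $q$ restricts to an isomorphism of $\mathcal E(\mathcal P)=\mathcal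 E(\mathcal G)$ onto $\mathcal E(\mathcal S)$. An order-preserving section is a map $j:\mathcal S\to\mathcal G$ with $q\circ j=\mathrm{id}_{\mathcal S}$, $j(1)=1$, and $j(s)\le j(t)$ whenever $s\le t$; it restricts to the inverse of $q|_{\mathcal E(\mathcal G)}$ on $\mathcal E(\mathcal S)$, so $j(\mathcal E(\mathcal S))=\operatorname{proj}(\mathcal D)$. Define $K:\mathcal S\times\mathcal S\to\mathcal D$ by $K(t,s)=j(s^\dagger t\wedge 1)$, and $k_s:\mathcal S\to\mathcal D$ by $k_s(t)=K(t,s)$; for $d\in\mathcal D$, $(k_sd)(t)=k_s(t)d$. On $\mathfrak A_0=\operatorname{span}\{k_sd: s\in\mathcal S,d\in\mathcal D\}$ there is a well-defined $\mathcal D$-valued inner product $\langle\sum_ik_{s_i}d_i,\sum_jk_{t_j}e_j\rangle=\sum_{i,j}d_i^*K(s_i,t_j)e_j$; its completion $\mathfrak A_{\mathcal D}$ is a right Hilbert $\mathcal D$-module of functions from $\mathcal S$ to $\mathcal D$. View $\mathcal N$ as a right Hilbert $\mathcal N$-module with $\langle x,y\rangle=x^*y$, let $\iota:\mathcal D\to\mathcal L(\mathcal N)$ be left multiplication, and let $\mathfrak A=\mathfrak A_{\mathcal D}\otimes_\iota\mathcal N$ be the interior tensor product, a right Hilbert $\mathcal N$-module with $\langle k_s\otimes x,k_t\otimes y\rangle=x^*K(s,t)y$. $\mathcal L(\mathfrak A)$ denotes the bounded adjointable operators on $\mathfrak A$. The cocycle-like function $\sigma:\mathcal G\times\mathcal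 S\to\mathcal P$ is $\sigma(v,s)=j(q(v)s)^\dagger\,v\,j(s)$ (which lies in $\mathcal P\subseteq\mathcal N$). A representation of $\mathcal G$ as partial isometries is a multiplicative map into the partial isometries with $\lambda(v^\dagger)=\lambda(v)^*$. *)

(* Defs.v *)
From HB Require Import structures.
From mathcomp Require Import all_boot all_order all_algebra all_real_closed.
From mathcomp Require Import all_classical all_reals all_analysis.

Set Implicit Arguments.
Unset Strict Implicit.
Unset Printing Implicit Defensive.

Import Order.TTheory GRing.Theory Num.Theory.
Import numFieldNormedType.Exports.

Local Open Scope classical_set_scope.
Local Open Scope ring_scope.

HB.mixin Record Monoid_isInverse S of Monoid S := {
  dag : S -> S;
  dag_regular : forall s : S, (s * dag s * s)%g = s;
  dag_inverse : forall s : S, (dag s * s * dag s)%g = dag s;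
  dag_unique : forall s t : S,
    (s * t * s)%g = s -> (t * s * t)%g = t -> t = dag s
}.
#[short(type="inverseMonoidType")]
HB.structure Definition InverseMonoid := { S of Monoid_isInverse S & Monoid S }.

HB.mixin Record InverseMonoid_hasZero S of InverseMonoid S := {
  mzero : S;
  mul_mzero : forall s : S, (mzero * s)%g = mzero;
  mulr_mzero : forall s : S, (s * mzero)%g = mzero
}.
#[short(type="inverseMonoid0Type")]
HB.structure Definition InverseMonoid0 :=
  { S of InverseMonoid_hasZero S & InverseMonoid S }.

Definition idempotents (S : inverseMonoidType) : set S :=
  [set e | (e * e)%g = e].
Arguments idempotents : clear implicits.

Definition natle (S : inverseMonoidType) (s t : S) : Prop :=
  exists2 e, idempotents S e & s = (t * e)%g.

Section InverseMonoidOrder.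
Variable S : inverseMonoidType.
Implicit Types s t m e f : S.

Definition is_meet s t m : Prop :=
  [/\ natle m s, natle m t & forall u, natle u s -> natle u t -> natle u m].

Definition is_join (A : set S) m : Prop :=
  (forall s, A s -> natle s m) /\
  (forall u, (forall s, A s -> natle s u) -> natle m u).

(* The bounds range over the poset of idempotents only. *)
Definition is_idem_join e f m : Prop :=
  [/\ idempotents S m, natle e m, natle f m &
      forall u, idempotents S u -> natle e u -> natle f u -> natle m u].

Definition fundamental : Prop :=
  forall s, (forall e, idempotents S e -> (s * e)%g = (e * s)%g) ->
            idempotents S s.

End InverseMonoidOrder.

Section BooleanInverseMonoid.
Variable S : inverseMonoid0Type.
Implicit Types s t e f g : S.

(* Junk value [mzero] when the meet does not exist. *)
Definition mmeet s t : S := xget mzero [set m | is_meet s t m].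

Definition orthogonal_elts s t : Prop :=
  (dag s * t)%g = mzero /\ (s * dag t)%g = mzero.

Definition is_compl e f : Prop :=
  (e * f)%g = mzero /\ is_idem_join e f 1%g.

(* Idempotents of an inverse monoid commute, their meet is their product, and
   [mzero] and [1] are the least and greatest idempotents. *)
Definition idempotents_boolean : Prop :=
  [/\ forall e f, idempotents S e -> idempotents S f ->
        exists m, is_idem_join e f m,
      forall e f g m, idempotents S e -> idempotents S f -> idempotents S g ->
        is_idem_join f g m -> is_idem_join (e * f)%g (e * g)%g (e * m)%g &
      forall e, idempotents S e -> exists2 f, idempotents S f & is_compl e f].

Definition complete_boolean : Prop :=
  [/\ idempotents_boolean,
      forall s t, exists m, is_meet s t m &
      forall A : set S,
        (forall s t, A s -> A t -> s <> t -> orthogonal_elts s t) ->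
        exists m, is_join A m].

Definition is_character (chi : idempotents S -> bool) : Prop :=
  [/\ forall e : idempotents S, \val e = mzero -> chi e = false,
      forall e : idempotents S, \val e = 1%g -> chi e = true,
      forall e f g : idempotents S,
        \val g = (\val e * \val f)%g -> chi g = chi e && chi f,
      forall e f g : idempotents S,
        is_idem_join (\val e) (\val f) (\val g) -> chi g = chi e || chi f &
      forall e f : idempotents S,
        is_compl (\val e) (\val f) -> chi f = ~~ chi e].

Definition character_set :
    set (prod_topology (fun _ : idempotents S => bool : topologicalType)) :=
  [set chi | is_character chi].

Definition character_space : topologicalType := set_type character_set.

End BooleanInverseMonoid.

(* The measurable structures of the library are built on pointed types. *)
Definition pointed_at (X : Type) (x : X) : Type := X.

Section PointedAt.
Variables (X : topologicalType) (x : X).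
HB.instance Definition _ := Topological.on (pointed_at x).
HB.instance Definition _ := isPointed.Build (pointed_at x) x.
End PointedAt.

Definition borel (X : topologicalType) (x : X) :=
  g_sigma_algebraType (@open (pointed_at x)).

Section Hyperstonean.
Variables (R : realType) (X : topologicalType).

Definition regular_measure (x : X)
    (mu : {finite_measure set (borel x) -> \bar R}) : Prop :=
  forall A : set (borel x), measurable A ->
    mu A = ereal_sup [set mu K | K in
             [set K : set (borel x) | compact (K : set X) /\ K `<=` A]].

(* The supremum [g] of [F] is taken in the lattice of continuous real
   functions; it need not be the pointwise supremum. *)
Definition normal_measure (x : X)
    (mu : {finite_measure set (borel x) -> \bar R}) : Prop :=
  forall (F : set (X -> R)) (g : X -> R),
    F !=set0 ->
    (forall f, F f -> continuous f) ->
    (forall f1 f2, F f1 -> F f2 ->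
       exists f3, [/\ F f3, forall y, f1 y <= f3 y & forall y, f2 y <= f3 y]) ->
    continuous g ->
    (forall f, F f -> forall y, f y <= g y) ->
    (forall h : X -> R, continuous h ->
       (forall f, F f -> forall y, f y <= h y) -> forall y, g y <= h y) ->
    (\int[mu]_(y in setT) (g y)%:E)%E =
    ereal_sup [set (\int[mu]_(y in setT) (f y)%:E)%E | f in F].

Definition stonean : Prop :=
  [/\ compact [set: X], hausdorff_space X &
      forall U : set X, open U -> open (closure U)].

Definition hyperstonean : Prop :=
  stonean /\
  forall f : X -> R, continuous f -> (forall y, 0 <= f y) ->
    forall x : X, f x != 0 ->
    exists mu : {finite_measure set (borel x) -> \bar R},
      [/\ regular_measure mu, normal_measure mu &
          (\int[mu]_(y in setT) (f y)%:E)%E != 0%E].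

End Hyperstonean.

Definition cartan (R : realType) (S : inverseMonoid0Type) : Prop :=
  [/\ fundamental S, complete_boolean S &
      hyperstonean R (character_space S)].

Definition bounded_linear (R : realType) (V : normedModType R[i])
    (T : V -> V) : Prop :=
  linear T /\ exists M : R[i], forall x, `|T x| <= M * `|x|.

(* Inner products are linear in the second variable. *)
Record hilbert (R : realType) := Hilbert {
  hilbert_car :> completeNormedModType R[i];
  dot : hilbert_car -> hilbert_car -> R[i];
  dot_linear : forall x a y z, dot x (a *: y + z) = a * dot x y + dot x z;
  dot_conj : forall x y, dot y x = Num.conj (dot x y);
  dot_norm : forall x, dot x x = `|x| ^+ 2
}.

Section Operators.
Variables (R : realType) (H : hilbert R).

(* Operators are bare functions [H -> H]; the sum, the scalar multiples and
   the zero are pointwise, the product is composition, the unit is [idfun]. *)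
Local Notation op := (H -> H).

Definition is_adjoint (T T' : op) : Prop :=
  bounded_linear T' /\ forall x y, dot (T x) y = dot x (T' y).

Definition adj (T : op) : op := xget (0 : op) [set T' | is_adjoint T T'].

Definition opnorm (T : op) : R :=
  inf [set c : R | 0 <= c /\ forall x, `|T x| <= (c%:C)%C * `|x|].

Definition positive_op (T : op) : Prop := forall x, 0 <= dot x (T x).

Definition commutant (M : set op) : set op :=
  [set T | bounded_linear T /\ forall U, M U -> T \o U = U \o T].

Record von_neumann (M : set op) : Prop := VonNeumann {
  vn_bounded : forall T, M T -> bounded_linear T;
  vn_id : M idfun;
  vn_add : forall T U, M T -> M U -> M (T + U);
  vn_scale : forall (c : R[i]) T, M T -> M (c *: T);
  vn_mul : forall T U, M T -> M U -> M (T \o U);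
  vn_adj : forall T, M T -> is_adjoint T (adj T) /\ M (adj T);
  vn_bicommutant : commutant (commutant M) = M
}.

Definition vn_center (N : set op) : set op := N `&` commutant N.

Definition partial_isometry_op (v : op) : Prop := v \o adj v \o v = v.

Definition GN (N L : set op) : set op :=
  [set v | [/\ N v, partial_isometry_op v &
               forall d, L d -> L (adj v \o d \o v) /\ L (v \o d \o adj v)]].

End Operators.

(* Right Hilbert module over a von Neumann algebra [B] of operators on [H].
   The action and the axioms only concern the operators lying in [B]. *)
Record hmodule (R : realType) (H : hilbert R) (B : set (H -> H)) := HModule {
  hm_car :> completeNormedModType R[i];
  hm_act : hm_car -> (H -> H) -> hm_car;
  ip : hm_car -> hm_car -> H -> H;
  actDl : forall xi eta b, B b -> hm_act (xi + eta) b = hm_act xi b + hm_act eta b;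
  actDr : forall xi b c, B b -> B c -> hm_act xi (b + c) = hm_act xi b + hm_act xi c;
  actZl : forall (a : R[i]) xi b, B b -> hm_act (a *: xi) b = a *: hm_act xi b;
  actZr : forall (a : R[i]) xi b, B b -> hm_act xi (a *: b) = a *: hm_act xi b;
  actM : forall xi b c, B b -> B c -> hm_act xi (b \o c) = hm_act (hm_act xi b) c;
  act1 : forall xi, hm_act xi idfun = xi;
  ip_in : forall xi eta, B (ip xi eta);
  ip_linear : forall xi (a : R[i]) eta zeta,
    ip xi (a *: eta + zeta) = a *: ip xi eta + ip xi zeta;
  ip_act : forall xi eta b, B b -> ip xi (hm_act eta b) = ip xi eta \o b;
  ip_adj : forall xi eta, ip eta xi = adj (ip xi eta);
  ip_pos : forall xi, positive_op (ip xi xi);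
  ip_norm : forall xi, `|xi| ^+ 2 = ((opnorm (ip xi xi))%:C)%C
}.

Section HilbertModuleOperators.
Variables (R : realType) (H : hilbert R) (B : set (H -> H)) (E : hmodule B).

Definition hm_adjoint (T T' : E -> E) : Prop :=
  forall xi eta, ip (T xi) eta = ip xi (T' eta).

Definition bounded_adjointable (T : E -> E) : Prop :=
  bounded_linear T /\ exists2 T', bounded_linear T' & hm_adjoint T T'.

Definition hm_partial_isometry (T : E -> E) : Prop :=
  bounded_adjointable T /\
  exists2 T', hm_adjoint T T' & T \o T' \o T = T.

End HilbertModuleOperators.

(* The interior tensor product of the Hilbert [D]-module [E] with [N], viewed
   as a Hilbert [N]-module with inner product [adj x \o y], along left
   multiplication of [D] on [N]. As any completion, it is given up to unitary
   isomorphism: a Hilbert [N]-module with elementary tensors having the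
   prescribed inner products and spanning a dense subspace. *)
Record interior_tensor (R : realType) (H : hilbert R) (D N : set (H -> H))
    (E : hmodule D) := InteriorTensor {
  it_mod :> hmodule N;
  tens : E -> (H -> H) -> it_mod;
  tensDl : forall xi eta x, N x -> tens (xi + eta) x = tens xi x + tens eta x;
  tensDr : forall xi x y, N x -> N y -> tens xi (x + y) = tens xi x + tens xi y;
  tensZl : forall (a : R[i]) xi x, N x -> tens (a *: xi) x = a *: tens xi x;
  tens_bal : forall xi d x, D d -> N x -> tens (hm_act xi d) x = tens xi (d \o x);
  tens_act : forall xi x y, N x -> N y -> hm_act (tens xi x) y = tens xi (x \o y);
  ip_tens : forall xi eta x y, N x -> N y ->
    ip (tens xi x) (tens eta y) = adj x \o ip xi eta \o y;
  tens_dense :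
    closure [set a : it_mod | exists n (xi : 'I_n -> E) (x : 'I_n -> H -> H),
      (forall k, N (x k)) /\ a = \sum_k tens (xi k) (x k)] = setT
}.

(* The completion of the span of the functions [fun t => K t s \o d], realised
   as a Hilbert [D]-module of functions from [S] to [D] through the injection
   [ev]; [fm_ev_ip] says that evaluation at [t] on the completion is the
   continuous extension of evaluation at [t] on the span. *)
Record function_module (R : realType) (H : hilbert R) (D : set (H -> H))
    (S : Type) (K : S -> S -> H -> H) := FunctionModule {
  fm_mod :> hmodule D;
  ev : fm_mod -> S -> H -> H;
  ev_in : forall xi t, D (ev xi t);
  ev_linear : forall (a : R[i]) xi eta t,
    ev (a *: xi + eta) t = a *: ev xi t + ev eta t;
  ev_act : forall xi d t, D d -> ev (hm_act xi d) t = ev xi t \o d;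
  ev_inj : injective ev;
  kfun : S -> fm_mod;
  ev_kfun : forall s t, ev (kfun s) t = K t s;
  ip_kfun : forall s t d e, D d -> D e ->
    ip (hm_act (kfun s) d) (hm_act (kfun t) e) = adj d \o K s t \o e;
  fm_ev_ip : forall xi t, ev xi t = ip (kfun t) xi;
  kfun_dense :
    closure [set a : fm_mod | exists n (s : 'I_n -> S) (d : 'I_n -> H -> H),
      (forall k, D (d k)) /\ a = \sum_k hm_act (kfun (s k)) (d k)] = setT
}.

Section Extensions.
Variables (R : realType) (H : hilbert R) (P : set (H -> H)).
Variables (G : inverseMonoidType) (S : inverseMonoid0Type).
Variables (i : (H -> H) -> G) (q : {multiplicative G -> S}) (j : S -> G).

(* Only the restriction of [i] to [P] matters. *)
Record extension : Prop := Extension {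
  ext_mul : forall v w, P v -> P w -> i (v \o w) = (i v * i w)%g;
  ext_inj : forall v w, P v -> P w -> i v = i w -> v = w;
  ext_surj : forall s, exists v, q v = s;
  ext_exact : i @` P = [set v | idempotents S (q v)];
  ext_idem : set_bij (idempotents G) (idempotents S) q
}.

Definition order_preserving_section : Prop :=
  [/\ cancel j q, j 1%g = 1%g & forall s t, natle s t -> natle (j s) (j t)].

(* The operator in [P] identified by [i] with [g] (0 if there is none). *)
Definition to_op (g : G) : H -> H :=
  xget (0 : H -> H) [set p | P p /\ i p = g].

Definition Kfun (t s : S) : H -> H := to_op (j (mmeet (dag s * t)%g 1%g)).

Definition sigma (v : G) (s : S) : H -> H :=
  to_op (dag (j (q v * s)%g) * v * j s)%g.

End Extensions.

(* Main.v *)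
Require Import Defs.
From HB Require Import structures.
From mathcomp Require Import all_boot all_order all_algebra all_real_closed.
From mathcomp Require Import all_classical all_reals all_analysis.
From mathcomp Require Import ring.

Set Implicit Arguments.
Unset Strict Implicit.
Unset Printing Implicit Defensive.

Import Order.TTheory GRing.Theory Num.Theory.
Import numFieldNormedType.Exports.

Local Open Scope classical_set_scope.
Local Open Scope ring_scope.

(** The operator [lambda v] moves the generator [k s x] to the generator with
index [q v * s], twisted by the cocycle [sigma v s].  The proof rests on two
identities about the generators.

The first is multiplicativity of the cocycle ([cocycleM]): in
[sigma v (q w * s) * sigma w s] the two inner values of the section multiply to
an idempotent which is the range projection of [w * j s], since [q] separates
idempotents, and it is absorbed.  Hence [lambda (v * w)] and
[lambda v \o lambda w] agree on generators.

The second is formal adjointness ([generator_adjoint]): moving one generator by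
[v] has the same effect on inner products as moving the other by [dag v].  Both
sides carry the projection [j e], where [e] is the meet of
[dag t * (q v * s)] and [1].  Below [e] the elements [q v * s] and [t] coincide
([natle_mulr]), and so do [dag (q v) * t] and [s].  The section respects
restriction to an idempotent ([section_mul_idem]), so after multiplication
by [j e] both sides become [dag (j s) * dag v * j t] ([cocycle_adjoint]).

Everything about [lambda v] on the span of the generators follows from these two
facts, with no estimate on [Kfun].  A linear combination of
generators with zero sum is sent to zero, because by adjointness its image is
orthogonal to the whole span.  With [e = dag v * v] the map [lambda e] is a
self-adjoint idempotent on the span, and
[<lambda v xi, lambda v xi> = <lambda e xi, lambda e xi> <= <xi, xi>], so
[lambda v] is contractive ([action_graph_contraction]).  The span is dense, so
[lambda v] extends to the module by completeness ([contraction_extension]), and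
all the identities extend by continuity ([dense_eq0]).  The relation
[v * dag v * v = v] makes [lambda v] a partial isometry.

For injectivity ([generator_inj]), the image of the generator at [s = 1],
[x = 1] suffices.  If [v] and [w] give the same image, comparing inner products
gives [dag v * v = dag w * w], and this element lies below [j f], where [f] is
the meet of [dag (q w) * q v] and [1].  Then [f] restricts neither [q v] nor
[q w], so [q v = q w].  The mixed inner product then gives
[dag v * v = dag v * w], which forces [v = w] ([cocycle1_inj]). *)

(** * Inverse monoids *)

Section InverseMonoidTheory.
Local Open Scope group_scope.
Variable S : inverseMonoidType.
Implicit Types s t a b e f : S.

Lemma dagK s : dag (dag s) = s.
Proof. by apply/esym/dag_unique; rewrite (dag_inverse, dag_regular). Qed.

Lemma dag_idem e : idempotents S e -> dag e = e.
Proof. by move=> eE; apply/esym/dag_unique; rewrite !eE. Qed.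

(** The inverse [x] of [e * f] equals [f * x * e], hence is idempotent; an
idempotent is its own inverse, so [e * f] is idempotent too. *)
Lemma idemM e f : idempotents S e -> idempotents S f -> idempotents S (e * f).
Proof.
move=> eE fE; have eE' : e * e = e := eE; have fE' : f * f = f := fE.
pose x := dag (e * f).
have r1 : e * f * x * (e * f) = e * f := dag_regular _.
have r2 : x * (e * f) * x = x := dag_inverse _.
have xE : x = f * x * e.
  apply/esym/dag_unique.
    have -> : e * f * (f * x * e) * (e * f) = e * (f * f) * x * ((e * e) * f).
      by rewrite !mulgA.
    by rewrite eE' fE' r1.
  have -> : f * x * e * (e * f) * (f * x * e) =
      f * (x * ((e * e) * (f * f)) * x) * e by rewrite !mulgA.
  by rewrite eE' fE' r2.
have xI : idempotents S x.
  rewrite /idempotents /= {1 2}xE.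
  have -> : f * x * e * (f * x * e) = f * (x * (e * f) * x) * e.
    by rewrite !mulgA.
  by rewrite r2 -xE.
by rewrite -(dagK (e * f)) -/x dag_idem.
Qed.

(** Both products are idempotent and each is an inverse of the other. *)
Lemma idemC e f : idempotents S e -> idempotents S f -> e * f = f * e.
Proof.
move=> eE fE; have eE' : e * e = e := eE; have fE' : f * f = f := fE.
have ef : e * f * (e * f) = e * f := idemM eE fE.
have fe : f * e * (f * e) = f * e := idemM fE eE.
rewrite -[LHS]dag_idem; last exact: ef.
apply/esym/dag_unique.
  have -> : e * f * (f * e) * (e * f) = e * (f * f) * ((e * e) * f).
    by rewrite !mulgA.
  by rewrite eE' fE' ef.
have -> : f * e * (e * f) * (f * e) = f * (e * e) * ((f * f) * e).
  by rewrite !mulgA.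
by rewrite eE' fE' fe.
Qed.

Lemma idem_dagl s : idempotents S (dag s * s).
Proof. by rewrite /idempotents /= mulgA dag_inverse. Qed.

Lemma idem_dagr s : idempotents S (s * dag s).
Proof. by rewrite /idempotents /= mulgA dag_regular. Qed.

Lemma idem1 : idempotents S 1.
Proof. exact: mulg1. Qed.

Lemma dagM s t : dag (s * t) = dag t * dag s.
Proof.
have C := idemC (idem_dagl s) (idem_dagr t).
apply/esym/dag_unique.
  have -> : s * t * (dag t * dag s) * (s * t) =
      s * (t * dag t * (dag s * s)) * t by rewrite !mulgA.
  by rewrite -C -[RHS](congr2 _ (dag_regular s) (dag_regular t)) !mulgA.
have -> : dag t * dag s * (s * t) * (dag t * dag s) =
    dag t * (dag s * s * (t * dag t)) * dag s by rewrite !mulgA.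
by rewrite C -[RHS](congr2 _ (dag_inverse t) (dag_inverse s)) !mulgA.
Qed.

Lemma idem_conj s e : idempotents S e -> idempotents S (dag s * e * s).
Proof.
move=> eE; have eE' : e * e = e := eE; rewrite /idempotents /=.
have -> : dag s * e * s * (dag s * e * s) =
    dag s * (e * (s * dag s) * e) * s by rewrite !mulgA.
rewrite (idemC eE (idem_dagr s)) -(mulgA (s * dag s)) eE'.
have -> : dag s * (s * dag s * e) * s = dag s * s * dag s * e * s.
  by rewrite !mulgA.
by rewrite dag_inverse.
Qed.

Lemma natle1 e : natle e 1 <-> idempotents S e.
Proof.
split=> [[f fE ->]|eE]; first by rewrite mul1g.
by exists e; rewrite ?mul1g.
Qed.

Lemma natleM s e : idempotents S e -> natle (s * e) s.
Proof. by exists e. Qed.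

(** An idempotent can be moved to the right past any element, at the price of a
conjugation. *)
Lemma idem_pass t e : idempotents S e -> e * t = t * (dag t * e * t).
Proof.
move=> eE.
have -> : t * (dag t * e * t) = t * dag t * e * t by rewrite !mulgA.
by rewrite (idemC (idem_dagr t) eE) -!mulgA (mulgA t) dag_regular.
Qed.

Lemma natle_idemMl t e : idempotents S e -> natle (e * t) t.
Proof. by move=> eE; rewrite idem_pass //; exact/natleM/idem_conj. Qed.

Lemma natle_dag s t : natle s t -> natle (dag s) (dag t).
Proof.
by move=> [e eE ->]; rewrite dagM (dag_idem eE); apply: natle_idemMl.
Qed.

Lemma natle_dagl s t : natle s t -> s = t * (dag s * s).
Proof.
move=> [e eE ->]; have eE' : e * e = e := eE.
rewrite dagM (dag_idem eE).
have -> : t * (e * dag t * (t * e)) = t * (e * (dag t * t) * e).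
  by rewrite !mulgA.
rewrite (idemC eE (idem_dagl t)) -(mulgA (dag t * t)) eE'.
by rewrite !mulgA dag_regular.
Qed.

Lemma natle_idem e a : idempotents S e -> natle e a -> a * e = e.
Proof. by move=> eE /natle_dagl; rewrite (dag_idem eE) eE. Qed.

(** The idempotents below [dag b * a] are those on which [a] and [b] restrict to
the same element with full source.  The reason: [dag (b * e) * (a * e) = e],
so [b * e] has source [e] and lies below [a * e], whose source is at most
[e]. *)
Lemma natle_mulr a b e : idempotents S e -> natle e (dag b * a) ->
  a * e = b * e.
Proof.
move=> eE le; have eE' : e * e = e := eE.
pose A := a * e; pose B := b * e.
have BA : dag B * A = e.
  rewrite dagM (dag_idem eE).
  have -> : e * dag b * A = e * (dag b * a * e) by rewrite !mulgA.
  by rewrite (natle_idem eE le) eE'.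
have Be : B * e = B by rewrite -mulgA eE'.
have BB : dag B * B = e.
  have -> : dag B * B = dag B * B * e by rewrite -mulgA Be.
  by rewrite -{1}BA mulgA dag_inverse.
have leBA : natle B A.
  rewrite -Be -BA mulgA; exact: natle_idemMl (idem_dagr B).
by rewrite -/A -/B (natle_dagl leBA) BB /A -mulgA eE'.
Qed.

End InverseMonoidTheory.

(** * Order-preserving sections and the cocycle *)

Section OrderPreservingSection.
Local Open Scope group_scope.
Variables (G : inverseMonoidType) (S : inverseMonoid0Type).
Variables (q : {multiplicative G -> S}) (j : S -> G).
Hypothesis q_idem : set_bij (idempotents G) (idempotents S) q.
Hypothesis j_section : order_preserving_section q j.
Implicit Types (v w g : G) (r s t e : S).

Let jK : cancel j q. Proof. by case: j_section. Qed.
Let j1 : j 1 = 1. Proof. by case: j_section. Qed.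

Lemma morph_dag v : q (dag v) = dag (q v).
Proof.
by apply: dag_unique; rewrite -!gmulfM ?dag_regular ?dag_inverse.
Qed.

Lemma section_idem e : idempotents S e -> idempotents G (j e).
Proof.
move=> /natle1 le_e1; apply/natle1; rewrite -j1.
by case: j_section => _ _; apply.
Qed.

Lemma morph_idem_inj g h : idempotents G g -> idempotents G h ->
  q g = q h -> g = h.
Proof. by case: q_idem => _ qI _ gE hE; apply: qI; rewrite inE. Qed.

Lemma section_morph_idem g : idempotents G g -> j (q g) = g.
Proof.
move=> gE; apply: morph_idem_inj; rewrite ?jK //.
by apply: section_idem; rewrite /idempotents /= -gmulfM gE.
Qed.

(** Both sides are restrictions of [j r], and restrictions of one element are
determined by their sources, hence by the images of the sources under [q]. *)
Lemma section_mul_idem r e : idempotents S e -> j (r * e) = j r * j e.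
Proof.
move=> eE.
have /natle_dagl -> : natle (j (r * e)) (j r).
  by case: j_section => _ _; apply; apply: natleM.
have jeE := section_idem eE.
have /natle_dagl E : natle (j r * j e) (j r) by apply: natleM.
rewrite [RHS]E.
congr (_ * _); apply: morph_idem_inj; try exact: idem_dagl.
by rewrite !gmulfM !morph_dag !gmulfM !jK.
Qed.

(** This is the part of the Clifford property that only uses that [q] separates
idempotents: [dag g * h * g] and [dag g * g * h] have the same image, since the
idempotents [q g] and [q h] commute. *)
Lemma kernel_idemC g h : idempotents S (q g) -> idempotents G h ->
  g * h = h * g.
Proof.
move=> qgE hE.
have qhE : idempotents S (q h) by rewrite /idempotents /= -gmulfM hE.
rewrite (idem_pass g hE).
have -> : dag g * h * g = dag g * g * h.
  apply: morph_idem_inj; first exact: idem_conj.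
    exact: idemM (idem_dagl g) hE.
  rewrite !gmulfM morph_dag (dag_idem qgE) -mulgA (idemC qhE qgE).
  by rewrite mulgA.
by rewrite !mulgA dag_regular.
Qed.

(** The element of the kernel of [q] which the inclusion of the Clifford monoid
identifies with the operator [sigma]. *)
Definition cocycle v s : G := dag (j (q v * s)) * v * j s.

Lemma morph_cocycle_idem v s : idempotents S (q (cocycle v s)).
Proof.
rewrite !gmulfM morph_dag !jK dagM -(mulgA _ (q v)) -dagM.
exact: idem_dagl.
Qed.

Lemma cocycleM v w s : cocycle v (q w * s) * cocycle w s = cocycle (v * w) s.
Proof.
have rangeE : j (q w * s) * dag (j (q w * s)) = w * j s * dag (w * j s).
  apply: morph_idem_inj; try exact: idem_dagr.
  by rewrite !gmulfM !morph_dag !gmulfM !jK.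
rewrite /cocycle gmulfM -(mulgA (q v)); set u := j (q w * s) in rangeE *.
have -> : dag (j (q v * (q w * s))) * v * u * (dag u * w * j s) =
    dag (j (q v * (q w * s))) * v * (u * dag u * (w * j s)) by rewrite !mulgA.
by rewrite rangeE dag_regular !mulgA.
Qed.

(** The cut by [j e] replaces [j (q v * s)] by [j t] and [j (dag (q v) * t)]
by [j s]; as [j e] commutes with the kernel of [q], it may be inserted on both
sides. *)
Lemma cocycle_adjoint v s t e : idempotents S e ->
  natle e (dag t * (q v * s)) ->
  dag (cocycle v s) * j e = j e * cocycle (dag v) t.
Proof.
move=> eE le_e.
have jeE := section_idem eE; have jeE' : j e * j e = j e := jeE.
have E1 : j (q v * s) * j e = j t * j e.
  by rewrite -!section_mul_idem // (natle_mulr eE le_e).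
have le_e' : natle e (dag s * (dag (q v) * t)).
  by move/natle_dag: le_e; rewrite (dag_idem eE) !dagM dagK mulgA.
have E2 : j (dag (q v) * t) * j e = j s * j e.
  by rewrite -!section_mul_idem // (natle_mulr eE le_e').
have E3 : j e * dag (j s) = j e * dag (j (dag (q v) * t)).
  by rewrite -(dag_idem jeE) -!dagM E2.
(* [j e] is central in the kernel, so one factor [j e] may be doubled. *)
have cut g : idempotents S (q g) -> g * j e = j e * g * j e.
  by move=> /kernel_idemC-/(_ _ jeE) gC; rewrite -gC -mulgA jeE'.
have daglE : q (dag (cocycle v s)) = q (cocycle v s).
  by rewrite morph_dag dag_idem //; apply: morph_cocycle_idem.
rewrite cut; last by rewrite daglE; apply: morph_cocycle_idem.
rewrite -(kernel_idemC (morph_cocycle_idem (dag v) t) jeE).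
rewrite (cut _ (morph_cocycle_idem (dag v) t)).
rewrite /cocycle !dagM dagK.
have -> : j e * (dag (j s) * (dag v * j (q v * s))) * j e =
    j e * dag (j s) * dag v * (j (q v * s) * j e) by rewrite !mulgA.
have -> : j e * (dag (j (q (dag v) * t)) * dag v * j t) * j e =
    j e * dag (j (q (dag v) * t)) * dag v * (j t * j e) by rewrite !mulgA.
by rewrite E1 E3 morph_dag.
Qed.

Lemma section_range u : j (q u) * dag (j (q u)) = u * dag u.
Proof.
apply: morph_idem_inj; try exact: idem_dagr.
by rewrite !gmulfM !morph_dag !jK.
Qed.

Lemma cocycle1_source v : dag (cocycle v 1) * cocycle v 1 = dag v * v.
Proof.
rewrite /cocycle j1 !mulg1 dagM dagK.
have -> : dag v * j (q v) * (dag (j (q v)) * v) =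
    dag v * (j (q v) * dag (j (q v))) * v by rewrite !mulgA.
by rewrite section_range !mulgA dag_inverse.
Qed.

Lemma cocycle1_norm v :
  dag (cocycle v 1) * j (dag (q v) * q v) * cocycle v 1 = dag v * v.
Proof.
have vvE : idempotents G (dag v * v) := idem_dagl v.
rewrite -morph_dag -gmulfM section_morph_idem // -mulgA.
rewrite -(kernel_idemC (morph_cocycle_idem v 1) vvE) mulgA cocycle1_source.
exact: vvE.
Qed.

(** The two equations are what is left of the inner products when [lambda v] and
[lambda w] agree on the generator at [1].  They make [dag v * v] and
[dag w * w] lie below [j f], so that [q v = q v * f = q w * f = q w]; then
[v] lies below [w] with the same source. *)
Lemma cocycle1_inj v w f : idempotents S f -> natle f (dag (q w) * q v) ->
  dag v * v = dag w * w ->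
  dag v * v = dag (cocycle v 1) * j f * cocycle w 1 ->
  v = w.
Proof.
move=> fE le_f src_vw vw.
have jfE := section_idem fE.
have cwf : cocycle w 1 * j f = j f * cocycle w 1.
  by apply: kernel_idemC jfE; apply: morph_cocycle_idem.
have vf : v * j f = v.
  have src_vf : dag v * v * j f = dag v * v.
    by rewrite vw -mulgA cwf (mulgA _ (j f)) -(mulgA _ (j f) (j f)) jfE.
  rewrite -{1}(dag_regular v) -!mulgA (mulgA (dag v)) src_vf.
  by rewrite mulgA dag_regular.
have wf : w * j f = w.
  rewrite -[in LHS](dag_regular w) -(mulgA w) -src_vw -!mulgA vf.
  by rewrite src_vw mulgA dag_regular.
have q_vw : q v = q w.
  by rewrite -vf -wf !gmulfM jK (natle_mulr fE le_f).
have vv : dag v * v = dag v * w.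
  rewrite vw -mulgA -cwf /cocycle j1 !mulg1 dagM dagK -q_vw.
  have -> : dag v * j (q v) * (dag (j (q v)) * w * j f) =
      dag v * (j (q v) * dag (j (q v))) * (w * j f) by rewrite !mulgA.
  by rewrite section_range wf !mulgA dag_inverse.
have /natle_dagl vE : natle v w.
  rewrite -(dag_regular v) -mulgA vv mulgA.
  exact: natle_idemMl (idem_dagr v).
by rewrite vE src_vw mulgA dag_regular.
Qed.

End OrderPreservingSection.

(** * Semi-inner products and operator norms *)

Section SesquilinearForms.
Variables (C : numClosedFieldType) (V : lmodType C).

Record semi_inner (B : V -> V -> C) : Prop := SemiInner {
  form_linear : forall x a y z, B x (a *: y + z) = a * B x y + B x z;
  form_conj : forall x y, B y x = (B x y)^*;
  form_ge0 : forall x, 0 <= B x x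
}.

Variable B : V -> V -> C.
Hypothesis semiB : semi_inner B.

Lemma form0r x : B x 0 = 0.
Proof.
have := form_linear semiB x 1 0 0.
by rewrite scale1r addr0 mul1r => /(canLR (addrK _)); rewrite subrr.
Qed.

Lemma formDr x y z : B x (y + z) = B x y + B x z.
Proof. by rewrite -{1}[y]scale1r (form_linear semiB) mul1r. Qed.

Lemma formZr x a y : B x (a *: y) = a * B x y.
Proof. by rewrite -[a *: y]addr0 (form_linear semiB) form0r addr0. Qed.

Lemma formBr x y z : B x (y - z) = B x y - B x z.
Proof. by rewrite formDr -scaleN1r formZr mulN1r. Qed.

Lemma formDl x y z : B (x + y) z = B x z + B y z.
Proof.
by rewrite !(form_conj semiB z) formDr rmorphD.
Qed.

Lemma formZl a x y : B (a *: x) y = a^* * B x y.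
Proof. by rewrite !(form_conj semiB y) formZr rmorphM. Qed.

Lemma formBl x y z : B (x - y) z = B x z - B y z.
Proof. by rewrite !(form_conj semiB z) formBr rmorphB. Qed.

Lemma form0l x : B 0 x = 0.
Proof. by rewrite (form_conj semiB x) form0r conjC0. Qed.

(** The usual vector [B x x *: y - B x y *: x] proves it when [B x x != 0], and
by symmetry when [B y y != 0].  When both vanish, [y - B x y *: x] has the
value [- 2 * `|B x y| ^+ 2], which must be nonnegative. *)
Lemma cauchy_schwarz x y : `|B x y| ^+ 2 <= B x x * B y y.
Proof.
have half u v : 0 <= B u u * (B u u * B v v - `|B u v| ^+ 2).
  have := form_ge0 semiB (B u u *: v - B u v *: u).
  rewrite formBr !formBl !formZr !formZl (form_conj semiB u v).
  rewrite (CrealP (ger0_real (form_ge0 semiB u))) normCK.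
  by congr (0 <= _); ring.
have [xx0|xx_neq0] := eqVneq (B x x) 0; last first.
  have xx_gt0 : 0 < B x x by rewrite lt_def xx_neq0 form_ge0.
  by have := half x y; rewrite pmulr_rge0 // subr_ge0.
have [yy0|yy_neq0] := eqVneq (B y y) 0; last first.
  have yy_gt0 : 0 < B y y by rewrite lt_def yy_neq0 form_ge0.
  have := half y x; rewrite pmulr_rge0 // subr_ge0 mulrC.
  by rewrite (form_conj semiB x y) norm_conjC.
have := form_ge0 semiB (y - B x y *: x).
rewrite formBr !formBl !formZr !formZl (form_conj semiB x y) xx0 yy0.
rewrite !mulr0 subr0 sub0r -opprD oppr_ge0.
by rewrite [_^* * _]mulrC -normCK -mulr2n pmulrn_lle0 // mul0r.
Qed.

End SesquilinearForms.

Section OperatorNorm.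
Variables (R : realType) (H : hilbert R).
Implicit Types (T U : H -> H) (x y : H).

Lemma dot_semi_inner : semi_inner (@dot R H).
Proof.
split; [exact: dot_linear|exact: dot_conj|].
by move=> x; rewrite dot_norm exprn_ge0.
Qed.

Lemma dot_eq0 x : dot x x = 0 -> x = 0.
Proof. by move=> /eqP; rewrite dot_norm expf_eq0 /= normr_eq0 => /eqP. Qed.

Lemma dot_injr y z : (forall x, dot x y = dot x z) -> y = z.
Proof.
move=> yz; apply/eqP; rewrite -subr_eq0; apply/eqP/dot_eq0.
by rewrite (formBr dot_semi_inner) yz subrr.
Qed.

Lemma norm_dot_le x y : `|dot x y| <= `|x| * `|y|.
Proof.
rewrite -ler_sqr ?nnegrE ?mulr_ge0 // exprMn -!dot_norm.
exact: cauchy_schwarz dot_semi_inner x y.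
Qed.

(** A bound [M] of a linear operator on the zero space need not be real. *)
Lemma linear_bound (V W : normedModType R[i]) (T : V -> W) (M : R[i]) (x : V) :
  `|T x| <= M * `|x| -> `|T x| <= `|M| * `|x|.
Proof.
move=> le_M; apply: (le_trans le_M).
have M_ge0 : 0 <= M * `|x| := le_trans (normr_ge0 _) le_M.
by rewrite -(ger0_norm M_ge0) normrM normr_id.
Qed.

Lemma real_complexRe (z : R[i]) : 0 <= z -> ((complex.Re z)%:C)%C = z.
Proof. by move=> z_ge0; rewrite RRe_real // ger0_real. Qed.

Lemma Re_ge0 (z : R[i]) : 0 <= z -> 0 <= complex.Re z.
Proof. by move=> z_ge0; rewrite -lecR real_complexRe. Qed.

Let bounds T := [set c : R | 0 <= c /\ forall x, `|T x| <= (c%:C)%C * `|x|].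

Let bounds_neq0 T : bounded_linear T -> bounds T !=set0.
Proof.
move=> [_ [M TM]]; exists (complex.Re `|M|).
split=> [|x]; first exact: Re_ge0.
by rewrite real_complexRe // linear_bound.
Qed.

Lemma opnorm_ge0 T : bounded_linear T -> 0 <= ((opnorm T)%:C)%C :> R[i].
Proof.
move=> bT; rewrite (_ : 0 = (0%:C)%C) // lecR.
by apply: lb_le_inf; [exact: bounds_neq0 | move=> c []].
Qed.

Lemma opnorm_bound T x : bounded_linear T ->
  `|T x| <= ((opnorm T)%:C)%C * `|x|.
Proof.
move=> bT; have [linT _] := bT.
have [->|x_neq0] := eqVneq x 0.
  have -> : T 0 = 0.
    by rewrite -[in LHS](addNr (0 : H)) -scaleN1r linT scaleN1r addNr.
  by rewrite !normr0 mulr0.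
have x_gt0 : 0 < `|x| by rewrite normr_gt0.
rewrite -ler_pdivrMr // -[leLHS]real_complexRe; last by rewrite divr_ge0.
rewrite lecR; apply: lb_le_inf; first exact: bounds_neq0.
move=> c [c_ge0 Tc].
by rewrite -lecR real_complexRe ?divr_ge0 // ler_pdivrMr.
Qed.

Lemma opnorm_le T (c : R[i]) : 0 <= c -> (forall x, `|T x| <= c * `|x|) ->
  ((opnorm T)%:C)%C <= c.
Proof.
move=> c_ge0 Tc; rewrite -(real_complexRe c_ge0) lecR; apply: ge_inf.
  by exists 0 => d [].
by split=> [|x]; rewrite ?Re_ge0 ?real_complexRe.
Qed.

End OperatorNorm.

(** * Bounded operators and Hilbert modules *)

Section BoundedOperators.
Variables (R : realType) (H : hilbert R).
Implicit Types (T U : H -> H) (M : set (H -> H)) (x y : H).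

Let dotS := @dot_semi_inner R H.

Section BoundedLinear.
Variable V : normedModType R[i].
Implicit Types (f : V -> V) (u w : V).

Lemma bounded_linearB f u w : bounded_linear f -> f (u - w) = f u - f w.
Proof. by move=> [linf _]; rewrite addrC -scaleN1r linf scaleN1r addrC. Qed.

Lemma bounded_linear0 f : bounded_linear f -> f 0 = 0.
Proof. by move=> bf; have := bounded_linearB 0 0 bf; rewrite !subrr. Qed.

Lemma bounded_linearD f u w : bounded_linear f -> f (u + w) = f u + f w.
Proof. by move=> [linf _]; rewrite -[u]scale1r linf !scale1r. Qed.

Lemma bounded_linearZ f a u : bounded_linear f -> f (a *: u) = a *: f u.
Proof.
move=> bf; have [linf _] := bf.
by rewrite -[a *: u]addr0 linf bounded_linear0 // addr0.
Qed.

End BoundedLinear.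

(** Polarization over the complex numbers. *)
Lemma quadratic_form_inj T U : bounded_linear T -> bounded_linear U ->
  (forall x, dot x (T x) = dot x (U x)) -> T = U.
Proof.
move=> bT bU TU; apply/funext => y; apply: dot_injr => x.
pose b u w := dot u (T w) - dot u (U w).
have b0 u : b u u = 0 by rewrite /b TU subrr.
have bD u w : b u w + b w u = 0.
  rewrite -[RHS](b0 (u + w)) /b !bounded_linearD // !(formDr dotS).
  rewrite !(formDl dotS).
  by have := b0 u; have := b0 w; rewrite /b => /subr0_eq-> /subr0_eq->; ring.
have biy u w : b u ('i *: w) = 'i * b u w.
  by rewrite /b !bounded_linearZ // !(formZr dotS) mulrBr.
have bix u w : b ('i *: w) u = - 'i * b w u.
  by rewrite /b !(formZl dotS) conjCi mulrBr.
have := bD x ('i *: y); rewrite biy bix mulNr -mulrBr => /eqP.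
rewrite mulf_eq0 (negPf (neq0Ci _)) /= subr_eq0 => /eqP bC.
have := bD x y; rewrite -bC -mulr2n => /eqP; rewrite mulrn_eq0 /= /b subr_eq0.
by move=> /eqP.
Qed.

Lemma adj_unique T U : bounded_linear U ->
  (forall x y, dot (T x) y = dot x (U y)) -> adj T = U.
Proof.
move=> bU TU; have adjTU : is_adjoint T U by [].
have : is_adjoint T (adj T) by rewrite /adj; case: xgetP => [_ -> //|/(_ U)].
move=> [_ TA]; apply/funext => y; apply: dot_injr => x.
by rewrite -TA TU.
Qed.

Section VonNeumann.
Variable M : set (H -> H).
Hypothesis vnM : von_neumann M.

Lemma dot_adj T x y : M T -> dot (T x) y = dot x (adj T y).
Proof. by move=> /(vn_adj vnM)[[_]]. Qed.

Lemma vn_adjK T : M T -> adj (adj T) = T.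
Proof.
move=> MT; apply: adj_unique; first exact: vn_bounded vnM _ MT.
by move=> x y; rewrite dot_conj -dot_adj // -dot_conj.
Qed.

Lemma vn_adjM T U : M T -> M U -> adj (T \o U) = adj U \o adj T.
Proof.
move=> MT MU; have [_ MT'] := vn_adj vnM MT; have [_ MU'] := vn_adj vnM MU.
apply: adj_unique; first by apply: (vn_bounded vnM); apply: (vn_mul vnM).
by move=> x y /=; rewrite !dot_adj.
Qed.

Lemma vn_adj_in T : M T -> M (adj T).
Proof. by move=> /(vn_adj vnM)[]. Qed.

End VonNeumann.

(** The operator norm of a positive operator is the supremum of its quadratic
form: apply the Cauchy-Schwarz inequality of the form [dot y (T z)] to the
vectors [T x] and [x]. *)
Lemma positive_op_bound T (c : R[i]) x : bounded_linear T -> adj T = T ->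
  (forall y z, dot (T y) z = dot y (adj T z)) -> positive_op T -> 0 <= c ->
  (forall y, dot y (T y) <= c * `|y| ^+ 2) -> `|T x| <= c * `|x|.
Proof.
move=> bT aT Tadj T_ge0 c_ge0 Tc.
have TS : semi_inner (fun y z => dot y (T z)).
  split=> // [y a z t|y z].
    by rewrite bounded_linearD // bounded_linearZ // (form_linear dotS).
  by rewrite -[T y]/(T y) dot_conj Tadj aT.
have [->|Tx_neq0] := eqVneq (T x) 0; first by rewrite normr0 mulr_ge0.
have Tx_gt0 : 0 < `|T x| by rewrite normr_gt0.
have := cauchy_schwarz TS (T x) x; rewrite dot_norm normrX normr_id => CS.
rewrite -ler_sqr ?nnegrE ?mulr_ge0 // -(ler_pM2l (exprn_gt0 2 Tx_gt0)).
rewrite -expr2; apply: (le_trans CS).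
apply: (@le_trans _ _ (c * `|T x| ^+ 2 * (c * `|x| ^+ 2))).
  by apply: ler_pM => //; rewrite T_ge0.
by rewrite le_eqVlt; apply/orP; left; apply/eqP; ring.
Qed.

End BoundedOperators.

Section HilbertModules.
Variables (R : realType) (H : hilbert R) (B : set (H -> H)).
Hypothesis vnB : von_neumann B.
Variable E : hmodule B.
Implicit Types (xi eta zeta : E) (h : H).

(** Each vector [h] turns the operator-valued inner product into a scalar one,
to which the Cauchy-Schwarz inequality applies.  By polarization these scalar
products determine the operator-valued one, and by [hm_norm_le] they determine
the norm. *)
Definition vector_form h xi eta : R[i] := dot h (ip xi eta h).

Let ipB xi eta : bounded_linear (ip xi eta) := vn_bounded vnB (ip_in xi eta).

Lemma vector_semi_inner h : semi_inner (vector_form h).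
Proof.
split=> [xi a eta zeta|xi eta|xi]; last exact: ip_pos.
  by rewrite /vector_form ip_linear (form_linear (@dot_semi_inner R H)).
by rewrite /vector_form ip_adj -(dot_adj vnB _ _ (ip_in _ _)) dot_conj.
Qed.

Lemma ip_eq xi eta xi' eta' :
  (forall h, vector_form h xi eta = vector_form h xi' eta') ->
  ip xi eta = ip xi' eta'.
Proof. by move=> eq_form; apply: quadratic_form_inj. Qed.

Lemma vector_form_le h xi : vector_form h xi xi <= (`|xi| * `|h|) ^+ 2.
Proof.
rewrite -[leLHS]ger0_norm ?(form_ge0 (vector_semi_inner h)) //.
apply: (le_trans (norm_dot_le _ _)).
rewrite exprMn ip_norm [_%:C%C * _]mulrC expr2 -mulrA.
by rewrite ler_wpM2l // mulrC opnorm_bound.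
Qed.

Lemma vector_form_bound h xi eta :
  `|vector_form h xi eta| <= `|h| ^+ 2 * `|xi| * `|eta|.
Proof.
rewrite -ler_sqr ?nnegrE ?mulr_ge0 //.
apply: (le_trans (cauchy_schwarz (vector_semi_inner h) xi eta)).
have -> : (`|h| ^+ 2 * `|xi| * `|eta|) ^+ 2 =
    (`|xi| * `|h|) ^+ 2 * (`|eta| * `|h|) ^+ 2 :> R[i] by ring.
by apply: ler_pM; rewrite ?(form_ge0 (vector_semi_inner h)) ?vector_form_le.
Qed.

Lemma hm_norm_le xi (c : R[i]) : 0 <= c ->
  (forall h, vector_form h xi xi <= (c * `|h|) ^+ 2) -> `|xi| <= c.
Proof.
move=> c_ge0 le_c; rewrite -ler_sqr ?nnegrE // ip_norm.
apply: opnorm_le => [|x]; first exact: exprn_ge0.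
apply: positive_op_bound => //.
- by rewrite -ip_adj.
- by move=> y z; rewrite (dot_adj vnB _ _ (ip_in _ _)).
- exact: ip_pos.
- exact: exprn_ge0.
- by move=> y; rewrite -exprMn; apply: le_c.
Qed.

End HilbertModules.

(** * Extension by density *)

Section DenseSubsets.
Variable R : realType.

Lemma closure_normP (V : normedModType R[i]) (A : set V) x :
  closure A x <-> forall e : R[i], 0 < e -> exists2 y, A y & `|x - y| < e.
Proof.
split=> [clA e e_gt0|approx U].
  have [y [Ay]] := clA _ (nbhsx_ballx x e e_gt0).
  by rewrite -ball_normE; exists y.
move=> /nbhs_ballP[e /= e_gt0 xeU]; have [y Ay xy] := approx e e_gt0.
by exists y; split=> //; apply: xeU; rewrite -ball_normE.
Qed.

(** Only additivity is asked of [f], so that this applies to the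
conjugate-linear first argument of an inner product as well as to the second. *)
Lemma dense_eq0 (V : normedModType R[i]) (W : normedZmodType R[i]) (A : set V)
    (f : V -> W) (M : R[i]) :
  closure A = setT -> (forall x y, f (x - y) = f x - f y) ->
  (forall x, `|f x| <= M * `|x|) -> (forall x, A x -> f x = 0) ->
  forall x, f x = 0.
Proof.
move=> denseA fB fM fA x; apply/eqP; apply: contraT => fx_neq0.
have fx_gt0 : 0 < `|f x| by rewrite normr_gt0.
have M1_gt0 : 0 < `|M| + 1 by rewrite ltr_wpDl.
have clAx : closure A x by rewrite denseA.
have [y Ay] := (closure_normP _ _).1 clAx _ (divr_gt0 fx_gt0 M1_gt0).
rewrite ltr_pdivlMr // => /lt_le_trans/(_ (lexx _)) lt_fx.
have : `|f x| < `|f x|; last by rewrite ltxx.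
apply: le_lt_trans lt_fx; rewrite -[f x]subr0 -(fA y Ay) -fB.
have M_ge0 : 0 <= M * `|x - y| := le_trans (normr_ge0 _) (fM _).
apply: (le_trans (fM _)); rewrite -(ger0_norm M_ge0) normrM normr_id mulrC.
by rewrite ler_wpM2l // lerDl.
Qed.

Section ContractionExtension.
Variables (V : completeNormedModType R[i]) (graph : V -> V -> Prop).
Hypothesis graph_linear : forall a x y x' y', graph x y -> graph x' y' ->
  graph (a *: x + x') (a *: y + y').
Hypothesis graph_contraction : forall x y, graph x y -> `|y| <= `|x|.
Hypothesis graph_dense : closure [set x | exists y, graph x y] = setT.

(** The closure of the graph: it is linear and contractive like the graph
itself, and it is defined everywhere because the module is complete. *)
Let limit_graph x y := forall e : R[i], 0 < e ->
  exists x' y', [/\ graph x' y', `|x - x'| < e & `|y - y'| < e].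

Let limit_linear a x y x' y' : limit_graph x y -> limit_graph x' y' ->
  limit_graph (a *: x + x') (a *: y + y').
Proof.
move=> xy xy' e e_gt0.
have e2_gt0 : 0 < e / 2 by rewrite divr_gt0.
have a1_gt0 : 0 < `|a| + 1 by rewrite ltr_wpDl.
have [u [w [uw xu yw]]] := xy _ (divr_gt0 e2_gt0 a1_gt0).
have [u' [w' [uw' xu' yw']]] := xy' _ e2_gt0.
have near z z' t t' : `|z - t| < e / 2 / (`|a| + 1) -> `|z' - t'| < e / 2 ->
    `|a *: z + z' - (a *: t + t')| < e.
  rewrite ltr_pdivlMr // => zt zt'.
  rewrite opprD addrACA -scalerBr [e](splitr e).
  apply: (le_lt_trans (ler_normD _ _)); apply: ler_ltD => //.
  rewrite normrZ mulrC; apply: le_trans (ltW zt).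
  by rewrite ler_wpM2l // lerDl.
exists (a *: u + u'), (a *: w + w').
by split; [exact: graph_linear|exact: near|exact: near].
Qed.

Let limit_contraction x y : limit_graph x y -> `|y| <= `|x|.
Proof.
move=> xy; apply/ler_addgt0Pr => e e_gt0.
have e2_gt0 : 0 < e / 2 by rewrite divr_gt0.
have [u [w [uw xu yw]]] := xy _ e2_gt0.
rewrite -[y](subrK w); apply: (le_trans (ler_normD _ _)).
rewrite [e](splitr e) addrC addrA; apply: lerD (ltW yw).
apply: (le_trans (graph_contraction uw)).
rewrite -[u](subrK x) addrC; apply: (le_trans (ler_normD _ _)).
by apply: lerD => //; rewrite distrC ltW.
Qed.

Let limit_total x : exists y, limit_graph x y.
Proof.
(* The radii are taken in [R] because the order of [R[i]] is not total. *)
pose near (e : R) : set V :=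
  [set w | exists2 u, graph u w & `|x - u| < (e%:C)%C].
pose F := filter_from [set e : R | 0 < e] near.
have near_neq0 e : 0 < e -> near e !=set0.
  move=> e_gt0; have clx : closure [set x | exists y, graph x y] x.
    by rewrite graph_dense.
  have eC_gt0 : 0 < (e%:C)%C :> R[i] by rewrite ltcR.
  have [u [w uw] xu] := (closure_normP _ _).1 clx _ eC_gt0.
  by exists w, u.
have FF : ProperFilter F.
  apply: filter_from_proper; last exact: near_neq0.
  apply: filter_from_filter; first by exists 1; rewrite /= ltr01.
  move=> d e /= d_gt0 e_gt0; exists (Num.min d e).
    by rewrite /= lt_min d_gt0 e_gt0.
  by move=> w [u uw xu]; split; exists u => //; apply: lt_le_trans xu _;
    rewrite lecR ge_min lexx ?orbT.
have Fcauchy : cauchy F.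
  apply: cauchy_exP => e e_gt0.
  have e2_gt0 : 0 < e / 2 by rewrite divr_gt0.
  have Re2_gt0 : 0 < complex.Re (e / 2) by rewrite -ltcR real_complexRe // ltW.
  have [w0 [u0 uw0]] := near_neq0 _ Re2_gt0.
  rewrite real_complexRe ?ltW // => xu0.
  exists w0, (complex.Re (e / 2)) => // w [u uw].
  rewrite real_complexRe ?ltW // => xu; rewrite -ball_normE /=.
  have uw0w : graph (u0 - u) (w0 - w).
    by have := graph_linear (-1) uw uw0; rewrite !scaleN1r ![- _ + _]addrC.
  apply: (le_lt_trans (graph_contraction uw0w)).
  rewrite -(subrK x u0) -addrA [e](splitr e).
  by apply: (le_lt_trans (ler_normD _ _)); rewrite distrC ltrD.
have Fy : F --> lim F := @cauchy_cvg V F FF Fcauchy.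
exists (lim F) => e e_gt0.
have [d /= d_gt0 dy] := Fy _ (nbhsx_ballx (lim F) e e_gt0).
have Re_gt0 : 0 < complex.Re e by rewrite -ltcR real_complexRe // ltW.
have [] := near_neq0 (Num.min d (complex.Re e)); first by rewrite lt_min d_gt0.
move=> w [u uw xu]; exists u, w; split=> //.
  apply: lt_le_trans xu _; rewrite -[leRHS](real_complexRe (ltW e_gt0)) lecR.
  by rewrite ge_min lexx orbT.
have : ball (lim F) e w.
  apply: dy; exists u => //; apply: lt_le_trans xu _.
  by rewrite lecR ge_min lexx.
by rewrite -ball_normE.
Qed.

(** Stating the extension for a graph spares the proof that a formula on a
spanning family is well defined: that is a consequence of contractivity. *)
Lemma contraction_extension : exists T : V -> V,
  [/\ linear T, forall x, `|T x| <= `|x| & forall x y, graph x y -> T x = y].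
Proof.
have [T Tgraph] := choice limit_total.
have Tunique x y : limit_graph x y -> T x = y.
  move=> xy; apply/eqP; rewrite -subr_eq0 -normr_le0.
  have := limit_contraction (limit_linear (-1) xy (Tgraph x)).
  by rewrite !scaleN1r addNr normr0 addrC.
exists T; split=> [a x y|x|x y xy].
- by apply: Tunique; apply: limit_linear.
- exact: limit_contraction.
- by apply: Tunique => e e_gt0; exists x, y; rewrite !subrr !normr0.
Qed.

End ContractionExtension.

End DenseSubsets.

Section Closures.
Variables (R : realType) (V : normedModType R[i]) (A : set V).
Hypothesis A0 : A 0.
Hypothesis AD : forall x y, A x -> A y -> A (x + y).

Lemma closure_add x y : closure A x -> closure A y -> closure A (x + y).
Proof.
move=> /closure_normP clx /closure_normP cly; apply/closure_normP => e e_gt0.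
have e2_gt0 : 0 < e / 2 by rewrite divr_gt0.
have [x' Ax' xx'] := clx _ e2_gt0; have [y' Ay' yy'] := cly _ e2_gt0.
exists (x' + y'); first exact: AD.
rewrite opprD addrACA [e](splitr e).
by apply: (le_lt_trans (ler_normD _ _)); apply: ltrD.
Qed.

Lemma closure_sum (n : nat) (x : 'I_n -> V) :
  (forall k, closure A (x k)) -> closure A (\sum_k x k).
Proof.
move=> clx; elim/big_ind: _ => //; first exact: subset_closure.
exact: closure_add.
Qed.

End Closures.

Lemma closure_approx (R : realType) (V : normedModType R[i]) (A : set V) x :
  (forall e : R[i], 0 < e -> exists2 y, closure A y & `|x - y| < e) ->
  closure A x.
Proof.
move=> approx; apply/closure_normP => e e_gt0.
have e2_gt0 : 0 < e / 2 by rewrite divr_gt0.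
have [y /closure_normP cly xy] := approx _ e2_gt0.
have [z Az yz] := cly _ e2_gt0; exists z => //.
rewrite -[x](subrK y) -addrA [e](splitr e).
by apply: (le_lt_trans (ler_normD _ _)); apply: ltrD.
Qed.

(** * Meets with the identity *)

Section Meets.
Local Open Scope group_scope.
Variable S : inverseMonoid0Type.
Hypothesis meets : forall s t : S, exists m, is_meet s t m.
Implicit Types s t e : S.

Lemma mmeetP s t : is_meet s t (mmeet s t).
Proof.
by rewrite /mmeet; case: xgetP => // nomeet; have [m /nomeet] := meets s t.
Qed.

Lemma mmeet1_idem s : idempotents S (mmeet s 1).
Proof. by have [_ /natle1] := mmeetP s 1. Qed.

Lemma mmeet1_le s : natle (mmeet s 1) s.
Proof. by have [] := mmeetP s 1. Qed.

Lemma mmeet_idem e : idempotents S e -> mmeet e 1 = e.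
Proof.
move=> eE; have mE := mmeet1_idem e.
have le_em : natle e (mmeet e 1).
  have [_ _] := mmeetP e 1; apply; last exact/natle1.
  by exists 1; [exact: idem1 | rewrite mulg1].
rewrite -(natle_idem mE (mmeet1_le e)) (idemC eE mE).
exact: natle_idem.
Qed.

End Meets.

(** * The Clifford monoid and its image in the extension *)

Section CliffordMonoid.
Variables (R : realType) (H : hilbert R) (N D : set (H -> H)).
Hypotheses (vnN : von_neumann N) (vnD : von_neumann D).
Hypothesis central : D `<=` vn_center N.
Implicit Types v w d x : H -> H.

Lemma center_commutes d x : D d -> N x -> d \o x = x \o d.
Proof. by move=> /central[_ [_]]; apply. Qed.

Lemma GN_range v : GN N D v -> D (v \o adj v).
Proof. by move=> [_ _ /(_ _ (vn_id vnD))[]]. Qed.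

Lemma GN_adj v : GN N D v -> GN N D (adj v).
Proof.
move=> [Nv pv normv]; have Nv' := vn_adj_in vnN Nv.
split=> // [|d Dd]; last first.
  by rewrite (vn_adjK vnN Nv); have [] := normv d Dd.
rewrite /partial_isometry_op (vn_adjK vnN Nv).
have := congr1 (@adj R H) pv.
by rewrite (vn_adjM vnN (vn_mul vnN Nv Nv') Nv) (vn_adjM vnN Nv Nv')
           (vn_adjK vnN Nv).
Qed.

(** The source projection of [v] and the range projection of [w] commute because
the latter lies in the center; this is why the product is again a partial
isometry. *)
Lemma GN_comp v w : GN N D v -> GN N D w -> GN N D (v \o w).
Proof.
move=> Pv Pw; have [Nv pv normv] := Pv; have [Nw pw normw] := Pw.
have Nv' := vn_adj_in vnN Nv; have Nw' := vn_adj_in vnN Nw.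
split=> [||d Dd]; first exact: (vn_mul vnN).
- rewrite /partial_isometry_op (vn_adjM vnN Nv Nw).
  have C : (w \o adj w) \o (adj v \o v) = (adj v \o v) \o (w \o adj w).
    by apply: center_commutes; [exact: GN_range | apply: (vn_mul vnN)].
  transitivity (v \o ((w \o adj w) \o (adj v \o v)) \o w) => //.
  rewrite C; transitivity ((v \o adj v \o v) \o (w \o adj w \o w)) => //.
  by rewrite pv pw.
- rewrite (vn_adjM vnN Nv Nw).
  have [dv _] := normv d Dd; have [_ wd] := normw d Dd.
  split; first by have [] := normw _ dv.
  by have [] := normv _ wd.
Qed.

End CliffordMonoid.

Section IdentifiedOperators.
Variables (R : realType) (H : hilbert R) (N D : set (H -> H)).
Hypotheses (vnN : von_neumann N) (vnD : von_neumann D).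
Hypothesis central : D `<=` vn_center N.
Variables (G : inverseMonoidType) (S : inverseMonoid0Type).
Variables (i : (H -> H) -> G) (q : {multiplicative G -> S}).
Hypothesis ext : extension (GN N D) i q.
Implicit Types g h : G.
Local Notation P := (GN N D).
Local Notation op := (to_op P i).

Local Notation kerP g := (idempotents S (q g)).

Lemma to_op_in g : kerP g -> P (op g).
Proof.
move=> gK; have [p Pp ip] : (i @` P) g by rewrite (ext_exact ext).
by rewrite /to_op; case: xgetP => [_ -> []//|/(_ p)[]].
Qed.

Lemma to_opK g : kerP g -> i (op g) = g.
Proof.
move=> gK; have [p Pp ip] : (i @` P) g by rewrite (ext_exact ext).
by rewrite /to_op; case: xgetP => [_ -> []//|/(_ p)[]].
Qed.

Lemma to_op_inj g h : kerP g -> kerP h -> op g = op h -> g = h.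
Proof. by move=> gK hK gh; rewrite -(to_opK gK) gh to_opK. Qed.

Lemma kernelM g h : kerP g -> kerP h -> kerP (g * h)%g.
Proof. by rewrite gmulfM; apply: idemM. Qed.

Lemma kernel_dag g : kerP g -> kerP (dag g).
Proof. by rewrite morph_dag => gK; rewrite (dag_idem gK). Qed.

Lemma kernel_idem g : idempotents G g -> kerP g.
Proof. by move=> gE; rewrite /idempotents /= -gmulfM gE. Qed.

Lemma to_opM g h : kerP g -> kerP h -> op (g * h)%g = op g \o op h.
Proof.
move=> gK hK; have Pg := to_op_in gK; have Ph := to_op_in hK.
apply: (ext_inj ext); first exact/to_op_in/kernelM.
  exact: GN_comp.
by rewrite (ext_mul ext) // !to_opK //; apply: kernelM.
Qed.

(** The inclusion carries the adjoint to the inverse because inverses in [G] are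
unique. *)
Lemma to_op_dag g : kerP g -> op (dag g) = adj (op g).
Proof.
move=> gK; have Pg := to_op_in gK; have Pg' := GN_adj vnN Pg.
have [_ pg _] := Pg; have [_ pg' _] := Pg'; have [Ng _ _] := Pg.
apply: (ext_inj ext) => //; first exact/to_op_in/kernel_dag.
rewrite to_opK; last exact: kernel_dag.
move: (to_opK gK) Pg Pg' pg pg' Ng; move: (op g) => p <- Pp Pp' pp pp' Np.
rewrite /partial_isometry_op (vn_adjK vnN Np) in pp'.
apply/esym/dag_unique.
  by rewrite -(ext_mul ext) // -(ext_mul ext) ?pp //; apply: GN_comp.
by rewrite -(ext_mul ext) // -(ext_mul ext) ?pp' //; apply: GN_comp.
Qed.

End IdentifiedOperators.

(** * The action on the span of the generators *)

Section Representation.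
Variables (R : realType) (H : hilbert R) (N D : set (H -> H)).
Hypotheses (vnN : von_neumann N) (vnD : von_neumann D).
Hypothesis central : D `<=` vn_center N.
Variables (S : inverseMonoid0Type) (G : inverseMonoidType).
Hypothesis meets : forall s t : S, exists m, is_meet s t m.
Variables (i : (H -> H) -> G) (q : {multiplicative G -> S}).
Hypothesis ext : extension (GN N D) i q.
Variable j : S -> G.
Hypothesis j_section : order_preserving_section q j.
Variables (AD : function_module D (Kfun (GN N D) i j)).
Variable A : interior_tensor N AD.
Implicit Types (v w : G) (s t : S) (x y : H -> H) (xi eta zeta : A).

Local Notation op := (to_op (GN N D) i).
Local Notation k s x := (tens A (kfun AD s) x).
Local Notation sgm v s := (sigma (GN N D) i q j v s).

Let q_idem := ext_idem ext.
Let cocycleK v s := morph_cocycle_idem j_section v s.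
Let D_in_N d : D d -> N d. Proof. by case/central. Qed.

Lemma sigma_in v s : N (sgm v s).
Proof. by have [] := to_op_in ext (cocycleK v s). Qed.

Lemma ip_generators s t x y : N x -> N y ->
  ip (k s x) (k t y) =
  adj x \o op (j (mmeet (dag t * s)%g 1%g)) \o y.
Proof. by move=> Nx Ny; rewrite ip_tens // -fm_ev_ip ev_kfun. Qed.

Lemma generator_scale s a x : N x -> k s (a *: x) = a *: k s x.
Proof.
move=> Nx; have Did : D (a *: idfun) := vn_scale vnD a (vn_id vnD).
rewrite -tensZl // -[in RHS](act1 (kfun AD s)) -actZr ?tens_bal //.
exact: vn_id.
Qed.

(** [Kfun] involves the same meet on both sides, because
[dag (q (dag v) * t) * s = dag t * (q v * s)]. *)
Lemma generator_adjoint v s t x y : N x -> N y ->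
  ip (k (q v * s)%g (sgm v s \o x)) (k t y) =
  ip (k s x) (k (q (dag v) * t)%g (sgm (dag v) t \o y)).
Proof.
move=> Nx Ny; have Ns := sigma_in v s; have Ns' := sigma_in (dag v) t.
rewrite !ip_generators //; try exact: (vn_mul vnN).
rewrite (vn_adjM vnN Ns Nx).
have -> : (dag (q (dag v) * t) * s = dag t * (q v * s))%g.
  by rewrite (morph_dag q) dagM dagK mulgA.
set e := mmeet _ _.
have eE : idempotents S e by apply: mmeet1_idem.
have jeK := kernel_idem q (section_idem j_section eE).
have E : adj (sgm v s) \o op (j e) = op (j e) \o sgm (dag v) t.
  rewrite /sigma -(to_op_dag vnN vnD central ext (cocycleK v s)).
  rewrite -(to_opM vnN vnD central ext (kernel_dag (cocycleK v s)) jeK).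
  rewrite -(to_opM vnN vnD central ext jeK (cocycleK (dag v) t)).
  rewrite (cocycle_adjoint (t := t) q_idem j_section eE) //.
  exact: mmeet1_le.
transitivity (adj x \o (adj (sgm v s) \o op (j e)) \o y) => //.
by rewrite E.
Qed.

(** The linear map determined by the formula on the span of the generators, as a
relation, because the generators are not linearly independent.  Scalars can be
absorbed into the operators [x], so sums of generators suffice. *)
Inductive action_graph v : A -> A -> Prop :=
| action_graph0 : action_graph v 0 0
| action_graphD s x xi eta : N x -> action_graph v xi eta ->
    action_graph v (k s x + xi) (k (q v * s)%g (sgm v s \o x) + eta).

Lemma action_graph_generator v s x : N x ->
  action_graph v (k s x) (k (q v * s)%g (sgm v s \o x)).
Proof.
move=> Nx; rewrite -[X in action_graph v X]addr0.
rewrite -[X in action_graph v _ X]addr0.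
exact: action_graphD (action_graph0 v).
Qed.

Lemma action_graph_linear v a xi eta xi' eta' :
  action_graph v xi eta -> action_graph v xi' eta' ->
  action_graph v (a *: xi + xi') (a *: eta + eta').
Proof.
move=> xieta xieta'; elim: xieta => [|s x z t Nx _ IH].
  by rewrite !scaler0 !add0r.
rewrite !scalerDr -!addrA -!generator_scale //; last first.
  by apply: (vn_mul vnN) => //; exact: sigma_in.
have -> : a *: (sgm v s \o x) = sgm v s \o (a *: x).
  apply/funext => h /=.
  by rewrite [RHS](bounded_linearZ _ _ (vn_bounded vnN (sigma_in v s))).
by apply: action_graphD => //; apply: (vn_scale vnN).
Qed.

Lemma action_graph_comp v w xi eta : action_graph w xi eta ->
  exists2 zeta, action_graph v eta zeta & action_graph (v * w)%g xi zeta.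
Proof.
elim=> [|s x z t Nx _ [u vtu vwzu]]; first by exists 0; constructor.
exists (k (q v * (q w * s))%g (sgm v (q w * s)%g \o (sgm w s \o x)) + u).
  apply: action_graphD => //; apply: (vn_mul vnN) => //; exact: sigma_in.
have -> : sgm v (q w * s)%g \o (sgm w s \o x) = sgm (v * w)%g s \o x.
  transitivity ((sgm v (q w * s)%g \o sgm w s) \o x) => //.
  rewrite /sigma -(to_opM vnN vnD central ext (cocycleK _ _) (cocycleK _ _)).
  by rewrite (cocycleM q_idem j_section).
by rewrite mulgA -gmulfM; apply: action_graphD.
Qed.

Let form h := @vector_semi_inner R H N vnN A h.

Lemma action_graph_adjoint v h xi eta xi' eta' :
  action_graph v xi eta -> action_graph (dag v) xi' eta' ->
  vector_form h eta xi' = vector_form h xi eta'.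
Proof.
move=> xieta xieta'; elim: xieta => [|s x z t Nx _ IH].
  by rewrite !(form0l (form h)).
rewrite !(formDl (form h)) {}IH; congr (_ + _).
elim: xieta' => [|s' x' z' t' Nx' _ IH]; first by rewrite !(form0r (form h)).
rewrite !(formDr (form h)) {}IH; congr (_ + _).
by rewrite /vector_form generator_adjoint.
Qed.

(** For [xi] mapped to [eta] by [v] and to [zeta] by [e = dag v * v],
adjointness gives [<eta, eta> = <xi, zeta> = <zeta, zeta>], which is at most
[<xi, xi>] by the Pythagorean identity for [zeta] and [xi - zeta]. *)
Lemma action_graph_contraction v xi eta :
  action_graph v xi eta -> `|eta| <= `|xi|.
Proof.
move=> xieta.
have [zeta etazeta xizeta] := action_graph_comp (dag v) xieta.
set e := (dag v * v)%g in xizeta.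
have eE : idempotents G e := idem_dagl v.
have [zeta' zetazeta'] := action_graph_comp e xizeta.
rewrite eE => xizeta'.
(* [e] maps [0] to [zeta - zeta'], which is then orthogonal to itself. *)
have zeta'E : zeta = zeta'.
  apply/eqP; rewrite -subr_eq0 -normr_le0; apply: (hm_norm_le vnN) => // h.
  rewrite mul0r expr0n /=.
  have diff : action_graph e 0 (zeta - zeta').
    have := action_graph_linear (-1) xizeta' xizeta.
    by rewrite !scaleN1r ![- _ + _]addrC subrr.
  have [u diffu _] := action_graph_comp e diff.
  rewrite (action_graph_adjoint h diff (eta' := u)) ?(form0l (form h)) //.
  by rewrite (dag_idem eE).
apply: (hm_norm_le vnN) => // h.
apply: le_trans (vector_form_le vnN h xi).
rewrite (action_graph_adjoint h xieta etazeta).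
have zz : vector_form h zeta zeta = vector_form h xi zeta.
  apply: action_graph_adjoint; first exact: xizeta.
  by rewrite (dag_idem eE) {2}zeta'E.
have zz' : vector_form h zeta xi = vector_form h zeta zeta.
  by rewrite (form_conj (form h) xi) -zz -(form_conj (form h)).
have := form_ge0 (form h) (xi - zeta).
by rewrite (formBr (form h)) !(formBl (form h)) zz' zz subrr subr0 subr_ge0.
Qed.

(** * The extension to the whole module *)

Let dom v : set A := [set xi | exists eta, action_graph v xi eta].

Let domD v xi xi' : dom v xi -> dom v xi' -> dom v (xi + xi').
Proof.
move=> [eta xieta] [eta' xieta']; exists (eta + eta').
by have := action_graph_linear 1 xieta xieta'; rewrite !scale1r.
Qed.

Lemma tens_norm_le (u : AD) x : N x ->
  `|tens A u x| <= ((opnorm x)%:C)%C * `|u|.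
Proof.
move=> Nx; have bx := vn_bounded vnN Nx.
have c_ge0 := opnorm_ge0 bx.
apply: (hm_norm_le vnN) => [|h]; first exact: mulr_ge0.
have -> : vector_form h (tens A u x) (tens A u x) = vector_form (x h) u u.
  by rewrite /vector_form ip_tens //= (dot_adj vnN).
apply: (le_trans (vector_form_le vnD _ _)).
rewrite ler_sqr ?nnegrE ?mulr_ge0 // mulrC -mulrA [_ * `|h|]mulrC mulrA.
by rewrite ler_wpM2r // opnorm_bound.
Qed.

(** Elementary tensors of arbitrary vectors are limits of sums of generators,
because [tens_norm_le] makes the tensor continuous in its first factor and
coefficients from [D] move to the second factor. *)
Lemma action_domain_dense v : closure (dom v) = setT.
Proof.
have dom0 : dom v 0 by exists 0; constructor.
have tens0l x : N x -> tens A 0 x = 0.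
  move=> Nx; have := tensDl A 0 0 Nx; rewrite addr0.
  by move=> /esym/(canRL (addrK _)); rewrite subrr.
have dom_tens u x : N x -> closure (dom v) (tens A u x).
  move=> Nx; apply: closure_approx => e e_gt0.
  have c_ge0 := opnorm_ge0 (vn_bounded vnN Nx).
  have c1_gt0 : 0 < ((opnorm x)%:C)%C + 1 :> R[i] by rewrite ltr_wpDl.
  have clu : closure [set a : AD |
      exists n (s : 'I_n -> S) (d : 'I_n -> H -> H),
      (forall l, D (d l)) /\ a = \sum_l hm_act (kfun AD (s l)) (d l)] u.
    by rewrite kfun_dense.
  have [u' [n [s [d [Dd u'E]]]] uu'] :=
    (closure_normP _ _).1 clu _ (divr_gt0 e_gt0 c1_gt0).
  exists (tens A u' x).
    apply: subset_closure; rewrite {}u'E.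
    elim/big_rec: _ => [|l w _]; first by rewrite tens0l.
    rewrite tensDl // tens_bal //; apply: domD.
    exists (k (q v * s l)%g (sgm v (s l) \o (d l \o x))).
    by apply: action_graph_generator; apply: (vn_mul vnN) => //; apply: D_in_N.
  have -> : tens A u x - tens A u' x = tens A (u - u') x.
    by rewrite tensDl // -[in RHS]scaleN1r tensZl // scaleN1r.
  apply: (le_lt_trans (tens_norm_le _ Nx)).
  rewrite ltr_pdivlMr // mulrC in uu'; apply: le_lt_trans uu'.
  by rewrite ler_wpM2r // lerDl.
apply/seteqP; split=> // xi _; apply: closure_approx => e e_gt0.
have cl : closure [set a : A | exists n (u : 'I_n -> AD) (x : 'I_n -> H -> H),
    (forall l, N (x l)) /\ a = \sum_l tens A (u l) (x l)] xi.
  by rewrite tens_dense.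
have [xi' [n [u [x [Nx ->]]]] xixi'] := (closure_normP _ _).1 cl _ e_gt0.
exists (\sum_l tens A (u l) (x l)) => //.
by apply: (closure_sum dom0 (@domD v)) => l; exact: dom_tens.
Qed.

Lemma action_extends v : exists T : A -> A,
  [/\ linear T, forall xi, `|T xi| <= `|xi| &
      forall xi eta, action_graph v xi eta -> T xi = eta].
Proof.
apply: contraction_extension.
- by move=> a xi eta xi' eta'; apply: action_graph_linear.
- by move=> xi eta; apply: action_graph_contraction.
- exact: action_domain_dense.
Qed.

Lemma contraction_bounded (T : A -> A) : linear T ->
  (forall xi, `|T xi| <= `|xi|) -> bounded_linear T.
Proof. by move=> linT cT; split=> //; exists 1 => xi; rewrite mul1r. Qed.

Lemma bounded_eq_on_domain v (T T' : A -> A) : bounded_linear T ->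
  bounded_linear T' -> (forall xi eta, action_graph v xi eta -> T xi = T' xi) ->
  T = T'.
Proof.
move=> bT bT' TT'; have [[_ [M TM]] [_ [M' TM']]] := (bT, bT').
apply/funext => xi; apply/eqP; rewrite -subr_eq0; apply/eqP; move: xi.
apply: (dense_eq0 (f := fun z => T z - T' z) (M := M + M')
  (action_domain_dense v)).
- move=> x y; rewrite (bounded_linearB x y bT) (bounded_linearB x y bT').
  by rewrite !opprD !opprK addrACA.
- by move=> xi; rewrite mulrDl; apply: (le_trans (ler_normB _ _)); apply: lerD.
- by move=> xi [eta /TT'->]; rewrite subrr.
Qed.

Lemma bounded_extends v (T : A -> A) : bounded_linear T ->
  (forall s x, N x -> T (k s x) = k (q v * s)%g (sgm v s \o x)) ->
  forall xi eta, action_graph v xi eta -> T xi = eta.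
Proof.
move=> bT Tk xi eta; elim=> [|s x z t Nx _ IH]; first exact: bounded_linear0.
by rewrite (bounded_linearD _ _ bT) Tk // IH.
Qed.

(** Adjointness passes to the limit in one variable at a time, for each scalar
form [vector_form h]. *)
Lemma extension_adjoint v (T T' : A -> A) : linear T -> linear T' ->
  (forall xi, `|T xi| <= `|xi|) -> (forall xi, `|T' xi| <= `|xi|) ->
  (forall xi eta, action_graph v xi eta -> T xi = eta) ->
  (forall xi eta, action_graph (dag v) xi eta -> T' xi = eta) ->
  hm_adjoint T T'.
Proof.
move=> linT linT' cT cT' Tv T'v xi eta.
have bT := contraction_bounded linT cT.
have bT' := contraction_bounded linT' cT'.
apply: (ip_eq vnN) => h; apply/eqP; rewrite -subr_eq0; apply/eqP.
have h2_ge0 : 0 <= `|h| ^+ 2 by rewrite exprn_ge0.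
have bound (u z t : A) :
    `|z| <= `|u| -> `|vector_form h z t| <= `|h| ^+ 2 * `|t| * `|u|.
  move=> zu; apply: (le_trans (vector_form_bound vnN h z t)).
  by rewrite mulrAC ler_wpM2l ?mulr_ge0.
move: eta; apply: (dense_eq0
  (f := fun eta => vector_form h (T xi) eta - vector_form h xi (T' eta))
  (M := `|h| ^+ 2 * `|T xi| + `|h| ^+ 2 * `|xi|) (action_domain_dense (dag v))).
- move=> x y; rewrite (bounded_linearB x y bT') !(formBr (form h)); ring.
- move=> eta; rewrite mulrDl; apply: (le_trans (ler_normB _ _)); apply: lerD.
    exact: vector_form_bound.
  apply: (le_trans (vector_form_bound vnN h _ _)).
  by rewrite ler_wpM2l ?mulr_ge0.
move=> eta [eta' /[dup] etaeta' /T'v ->]; move: xi; apply: (dense_eq0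
  (f := fun xi => vector_form h (T xi) eta - vector_form h xi eta')
  (M := `|h| ^+ 2 * `|eta| + `|h| ^+ 2 * `|eta'|) (action_domain_dense v)).
- move=> x y; rewrite (bounded_linearB x y bT) !(formBl (form h)); ring.
- move=> xi; rewrite mulrDl; apply: (le_trans (ler_normB _ _)); apply: lerD.
    exact: bound.
  exact: bound.
- move=> xi [xi' /[dup] xixi' /Tv ->].
  by rewrite (action_graph_adjoint h xixi' etaeta') subrr.
Qed.

(** The inner squares of the two vectors are [dag v * v] and [dag w * w], and
their mixed inner product is the product in [cocycle1_inj]. *)
Lemma generator_inj v w :
  k (q v * 1)%g (sgm v 1%g \o idfun) = k (q w * 1)%g (sgm w 1%g \o idfun) ->
  v = w.
Proof.
move=> kvw; have Nid := vn_id vnN.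
have jK s : idempotents S s -> idempotents S (q (j s)).
  by move=> sE; exact: kernel_idem (section_idem j_section sE).
have cK u := cocycleK u 1%g.
have cdK u := kernel_dag (cK u).
have dagE u u' : adj (sgm u 1%g \o idfun) \o
      op (j (mmeet (dag (q u' * 1) * (q u * 1))%g 1%g)) \o
      (sgm u' 1%g \o idfun) =
    op (dag (cocycle q j u 1) * j (mmeet (dag (q u') * q u) 1) *
        cocycle q j u' 1)%g.
  have mE := jK _ (mmeet1_idem meets (dag (q u') * q u)%g).
  rewrite !mulg1 (to_opM vnN vnD central ext (kernelM (cdK u) mE) (cK u')).
  rewrite (to_opM vnN vnD central ext (cdK u) mE).
  by rewrite (to_op_dag vnN vnD central ext (cK u)).
have ipE u u' := ip_generators (q u * 1)%g (q u' * 1)%g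
  (vn_mul vnN (sigma_in u 1%g) Nid) (vn_mul vnN (sigma_in u' 1%g) Nid).
have normE u : ip (k (q u * 1)%g (sgm u 1%g \o idfun))
    (k (q u * 1)%g (sgm u 1%g \o idfun)) = op (dag u * u)%g.
  rewrite ipE dagE mmeet_idem //; last exact: idem_dagl.
  by rewrite (cocycle1_norm q_idem j_section).
have uuK u : idempotents S (q (dag u * u)%g).
  exact: kernel_idem (idem_dagl u).
pose f := mmeet (dag (q w) * q v)%g 1%g.
have fE : idempotents S f by apply: mmeet1_idem.
apply: (cocycle1_inj q_idem j_section fE (mmeet1_le meets _)).
  by apply: (to_op_inj ext (uuK v) (uuK w)); rewrite -!normE kvw.
apply: (to_op_inj ext (uuK v)).
  by apply: kernelM (cK w); apply: kernelM (cdK v) (jK _ fE).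
by rewrite -dagE -ipE -kvw normE.
Qed.

End Representation.

Theorem theorem3p2 (R : realType) (H : hilbert R) (N D : set (H -> H))
    (hN : von_neumann N) (hD : von_neumann D) (hDN : D `<=` vn_center N)
    (S : inverseMonoid0Type) (hS : cartan R S)
    (G : inverseMonoidType)
    (i : (H -> H) -> G) (q : {multiplicative G -> S})
    (hext : extension (GN N D) i q)
    (j : S -> G) (hj : order_preserving_section q j)
    (AD : function_module D (Kfun (GN N D) i j))
    (A : interior_tensor N AD) :
  let k (s : S) (x : H -> H) : A := tens A (kfun AD s) x in
  let formula (v : G) (T : A -> A) : Prop :=
    forall (s : S) (x : H -> H), N x ->
      T (k s x) = k (q v * s)%g (sigma (GN N D) i q j v s \o x) in
  exists lambda : G -> A -> A,
    (forall v, [/\ formula v (lambda v), hm_partial_isometry (lambda v) &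
       forall T, bounded_adjointable T -> formula v T -> T = lambda v]) /\
    [/\ forall v w, lambda (v * w)%g = lambda v \o lambda w,
        forall v, hm_adjoint (lambda v) (lambda (dag v)) &
        injective lambda].
Proof.
move=> k formula.
have [_ [_ meets _] _] := hS.
have [lambda lambdaP] :=
  choice (action_extends hN hD hDN meets hext hj A).
have lin v : linear (lambda v) by have [] := lambdaP v.
have contr v xi : `|lambda v xi| <= `|xi| by have [_ ->] := lambdaP v.
have graphP v xi eta : action_graph q v xi eta -> lambda v xi = eta.
  by have [_ _] := lambdaP v; apply.
have bnd v : bounded_linear (lambda v) by apply: contraction_bounded.
have lambda_formula v : formula v (lambda v).
  by move=> s x Nx; apply/graphP/action_graph_generator.
have adjP v : hm_adjoint (lambda v) (lambda (dag v)).
  apply: (extension_adjoint hN hD hDN meets hext hj (v := v)) => //.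
  - exact: graphP.
  - exact: graphP.
have mulP v w : lambda (v * w)%g = lambda v \o lambda w.
  have bvw : bounded_linear (lambda v \o lambda w).
    apply: contraction_bounded => [a xi eta|xi] /=; first by rewrite !lin.
    exact: le_trans (contr v _) (contr w _).
  apply: (bounded_eq_on_domain hN hD hDN hext hj (v := w)) => //.
  move=> xi eta xieta.
  have [zeta] := action_graph_comp hN hD hDN hext hj v xieta.
  by move=> /graphP <- /graphP -> /=; rewrite (graphP _ _ _ xieta).
exists lambda; split=> [v|]; last split=> //.
- split=> // [|T [bT _] TP].
    split; first by split=> //; exists (lambda (dag v)).
    by exists (lambda (dag v)) => //; rewrite -!mulP dag_regular.
  apply: (bounded_eq_on_domain hN hD hDN hext hj (v := v)) => //.
  move=> xi eta xieta; rewrite (graphP _ _ _ xieta).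
  exact: (bounded_extends bT TP xieta).
- move=> v w vw; apply: (generator_inj hN hD hDN meets hext hj (A := A)).
  have Nid := vn_id hN.
  by rewrite -[LHS](lambda_formula v 1%g _ Nid) vw (lambda_formula w 1%g _ Nid).
Qed.
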